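(* Let $\mathbf a=\{a_i\}_{i=1}^\infty$ be an increasing sequence of positive real numbers. (1) Suppose that for every real $r>0$ and every integer $n\ge 2$, $$(n-i)\frac{a^r_{n+1-i}}{a^r_{n-i}}+1\le (n-i+1)\frac{a^r_{n+2-i}}{a^r_{n+1-i}},\qquad 1\le i\le n-1.$$ Then for every integer $n\ge1$ the function $r\mapsto R_n(r;\mathbf a)$ is decreasing on $[0,\infty)$. (2) Suppose that for every real $r>0$ and every integer $n\ge2$, $$(i+1)\frac{a^r_{i+1}}{a^r_{i+2}}\le 1+i\,\frac{a^r_i}{a^r_{i+1}},\qquad 1\le i\le n-1.$$ Then for every integer $n\ge1$ the function $r\mapsto R_n(r;\mathbf a)$ is decreasing on $(-\infty,0]$.
   Context: For an increasing sequence $\mathbf a=\{a_i\}_{i=1}^\infty$ of positive real numbers, an integer $n\ge1$ and a real number $r\ne0$, $$R_n(r;\mathbf a)=\left(\frac{\frac1n\sum_{i=1}^n a_i^r}{\frac1{n+1}\sum_{i=1}^{n+1} a_i^r}\right)^{1/r},\qquad\text{and}\qquad R_n(0;\mathbf a)=\frac{\sqrt[n]{\prod_{i=1}^n a_i}}{\sqrt[n+1]{\prod_{i=1}^{n+1}a_i}}.$$ ''Increasing'' and ''decreasing'' are meant in the non-strict sense. *)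

(* Defs.v *)
From mathcomp Require Import all_boot all_order all_algebra.
From mathcomp Require Import all_classical all_reals all_analysis.

Set Implicit Arguments.
Unset Strict Implicit.
Unset Printing Implicit Defensive.

Import Order.TTheory GRing.Theory Num.Theory.
Local Open Scope ring_scope.

(* Sequences are indexed from 1, as in the source: [a 0] is never used. *)

Definition power_avg (R : realType) (a : nat -> R) (n : nat) (r : R) : R :=
  n%:R^-1 * \sum_(1 <= i < n.+1) a i `^ r.

Definition geometric_mean (R : realType) (a : nat -> R) (n : nat) : R :=
  (\prod_(1 <= i < n.+1) a i) `^ n%:R^-1.

Definition mean_ratio (R : realType) (a : nat -> R) (n : nat) (r : R) : R :=
  if r == 0 then geometric_mean a n / geometric_mean a n.+1
  else (power_avg a n r / power_avg a n.+1 r) `^ r^-1.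

(* Main.v *)
Require Import Defs.
From mathcomp Require Import all_boot all_order all_algebra.
From mathcomp Require Import all_classical all_reals all_analysis.
From mathcomp Require Import ring lra.

(**
Write A_n(r) for the average of a_1^r, ..., a_n^r. For 0 < s < r put
p = r / s, so that R_n(r) <= R_n(s) says that the mean of (x_i / A_n)^p over
i <= n, where x_i = a_i^s and A_n = A_n(s), does not exceed the same mean
taken over i <= n + 1 with A_{n+1} as divisor. For s = 0 the same comparison,
made with x_i = a_i^r and - ln in place of t^p, is R_n(r) <= R_n(0).
Both are instances of one inequality for a convex function phi, and it holds
because the normalized family x_i / A_{n+1} (i <= n + 1) is more spread out, in
the sense of majorization, than x_i / A_n (i <= n).

To compare families of sizes n and n + 1, cut [0, 1] into n equal intervals and
into n + 1 equal intervals. The i-th interval of the first cutting meets the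
i-th and the (i+1)-st of the second one, with weights proportional to
n + 1 - i and i. Bounding phi from below by its tangent at u_i = x_i / A_n, and
summing with these weights, leaves a sum of g(u_i) d_i, where g is the slope of
phi and d_i measures how much the second family exceeds the first one on the
i-th interval. Abel summation makes this sum nonnegative as soon as the partial
sums of d have the sign opposite to that of the increments of u
([normalized_convex_mean_le]). Up to a positive factor these partial sums are
    k x_{k+1} / X_k - n x_{n+1} / X_n,   where X_k = x_1 + ... + x_k,
so everything reduces to the monotonicity in n of n x_{n+1} / X_n. The
hypotheses on the quotients of consecutive terms yield it by induction
([slope_monotone]).

Negative exponents r lead to the same argument for the decreasing sequence
1 / a_i and the exponents - r ([mean_ratioV]): then x is decreasing, all the inequalities above
are reversed, and the product in the Abel summation keeps its sign. A nonzero
factor sg, positive for increasing and negative for decreasing sequences,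
carries both cases through one proof.
*)

Import Order.TTheory GRing.Theory Num.Theory.
Local Open Scope ring_scope.

Set Implicit Arguments.
Unset Strict Implicit.

(** * Partial sums *)

Definition psum {R : realType} (x : nat -> R) (n : nat) : R :=
  \sum_(1 <= i < n.+1) x i.

Lemma psum0 (R : realType) (x : nat -> R) : psum x 0 = 0.
Proof. by rewrite /psum big_geq. Qed.

Lemma psumS (R : realType) (x : nat -> R) n : psum x n.+1 = psum x n + x n.+1.
Proof. by rewrite /psum big_nat_recr. Qed.

Lemma psum_gt0 (R : realType) (x : nat -> R) :
  (forall i, (1 <= i)%N -> 0 < x i) -> forall n, (1 <= n)%N -> 0 < psum x n.
Proof.
move=> x_gt0; case=> // n _; elim: n => [|n IHn].
  by rewrite psumS psum0 add0r x_gt0.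
by rewrite psumS addr_gt0 // x_gt0.
Qed.

Lemma psum_mulr (R : realType) (x : nat -> R) c n :
  psum (fun i => c * x i) n = c * psum x n.
Proof. by rewrite /psum big_distrr. Qed.

Lemma psumD (R : realType) (x y : nat -> R) n :
  psum (fun i => x i + y i) n = psum x n + psum y n.
Proof. by rewrite /psum big_split. Qed.

Lemma ler_psum (R : realType) (x y : nat -> R) n :
  (forall i, (1 <= i <= n)%N -> x i <= y i) -> psum x n <= psum y n.
Proof.
by move=> xy; rewrite /psum; exact: ler_sum_nat.
Qed.

Lemma eq_psum (R : realType) (x y : nat -> R) n :
  (forall i, (1 <= i)%N -> x i = y i) -> psum x n = psum y n.
Proof. by move=> xy; apply: eq_big_nat => i /andP[i_ge1 _]; exact: xy. Qed.

(** The total weight with which the overlapping intervals below m / n pick up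
    the terms w_i: each w_j with j <= m is met by the intervals j - 1 and j,
    with weights j - 1 and n + 1 - j that add up to n, and the interval m also
    reaches w_{m+1} with weight m. *)
Lemma psum_overlap (R : realType) (w : nat -> R) (n m : nat) :
  psum (fun i => (n%:R + 1 - i%:R) * w i + i%:R * w i.+1) m
  = n%:R * psum w m + m%:R * w m.+1.
Proof.
elim: m => [|m IHm]; first by rewrite !psum0; ring.
by rewrite !psumS IHm -!(@natr1 R m); ring.
Qed.

(** Summation by parts: the difference of the two sides is the sum over k < m
    of (y_k - y_{k+1}) times the k-th partial sum of d. *)
Lemma abel_sum_ge (R : realType) (y d : nat -> R) (m : nat) :
    (1 <= m)%N ->
    (forall k, (1 <= k < m)%N -> 0 <= (y k - y k.+1) * psum d k) ->
  y m * psum d m <= psum (fun i => y i * d i) m.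
Proof.
case: m => // m _; elim: m => [|m IHm] H; first by rewrite !psumS !psum0; lra.
rewrite !(psumS _ m.+1).
have : y m.+1 * psum d m.+1 <= psum (fun i => y i * d i) m.+1.
  by apply: IHm => k /andP[k_ge1 km]; apply: H; rewrite k_ge1 ltnW.
have : 0 <= (y m.+1 - y m.+2) * psum d m.+1 by apply: H; rewrite ltnS leqnn.
by lra.
Qed.

(** * Monotonicity of the ratio of a term to the average of its predecessors *)

(** With c_k = k x_{k+1} / x_k and d_n = n x_{n+1} / X_n one has
    d_{n+1} = c_{n+1} d_n / (n + d_n), so d_{n+1} - d_n has the sign of the gap
    c_{n+1} - n - d_n. By induction the gap has the sign of the differences
    c_{k+1} - c_k - 1: the next gap is c_{n+2} - c_{n+1} - 1 plus
    c_{n+1} - n - d_{n+1}, and the recurrence shows that the latter is the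
    present gap times n / (n + d_n). *)
Lemma slope_monotone (R : realType) (x : nat -> R) (sg : R) :
    (forall i, (1 <= i)%N -> 0 < x i) ->
    (forall k, (1 <= k)%N ->
       0 <= sg * (k.+1%:R * (x k.+2 / x k.+1) - k%:R * (x k.+1 / x k) - 1)) ->
  forall k n, (1 <= k)%N -> (k <= n)%N ->
    0 <= sg * (n%:R * x n.+1 / psum x n - k%:R * x k.+1 / psum x k).
Proof.
move=> x_gt0 step.
pose c n := n%:R * (x n.+1 / x n).
pose d n := n%:R * x n.+1 / psum x n.
pose gap n := c n.+1 - n%:R - d n.
have d_gt0 n : (1 <= n)%N -> 0 < d n.
  by move=> n_ge1; rewrite divr_gt0 ?mulr_gt0 ?ltr0n ?x_gt0 ?psum_gt0.
have D_gt0 n : (1 <= n)%N -> 0 < n%:R + d n.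
  by move=> n_ge1; rewrite addr_gt0 ?ltr0n ?d_gt0.
have dS n : (1 <= n)%N -> d n.+1 = c n.+1 * d n / (n%:R + d n).
  move=> n_ge1; have S_gt0 : 0 < psum x n by exact: psum_gt0.
  have xn_gt0 : 0 < x n.+1 by exact: x_gt0.
  have n_gt0 : 0 < n%:R :> R by rewrite ltr0n.
  rewrite /d /c psumS; field.
  by rewrite !gt_eqF ?addr_gt0 ?mulr_gt0.
have gap_ge0 n : (1 <= n)%N -> 0 <= sg * gap n.
  elim: n => // -[_ _|n IHn _].
    by have := step 1%N isT; rewrite /gap /c /d psumS psum0 add0r !mul1r; lra.
  have -> : sg * gap n.+2 = sg * (c n.+3 - c n.+2 - 1)
      + n.+1%:R / (n.+1%:R + d n.+1) * (sg * gap n.+1).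
    rewrite /gap dS // -(natr1 n.+1); field.
    by have := D_gt0 n.+1 isT; rewrite -nat1r => /gt_eqF ->.
  rewrite addr_ge0 ?step // mulr_ge0 ?IHn // divr_ge0 //.
  by rewrite ltW ?D_gt0.
move=> k n k_ge1 /subnKC <-; elim: (n - k)%N => [|j IHj].
  by rewrite addn0 subrr mulr0.
rewrite addnS; move: IHj; set m := (k + j)%N.
rewrite -/(d k) -/(d m) -/(d m.+1) => IHj.
have m_ge1 : (1 <= m)%N by rewrite addn_gt0 k_ge1.
have -> : sg * (d m.+1 - d k)
    = sg * (d m - d k) + d m / (m%:R + d m) * (sg * gap m).
  rewrite /gap dS //; field.
  by rewrite gt_eqF ?D_gt0.
rewrite addr_ge0 // mulr_ge0 ?gap_ge0 // divr_ge0 // ltW //.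
- exact: d_gt0.
- exact: D_gt0.
Qed.

(** * Convex means of a sequence normalized by its average *)

(** The hypotheses on phi and g say that phi is convex with subgradient g on the
    positive reals. With v_i = x_i / A_{n+1}, the k-th partial sum of
    d_i = (n + 1 - i) v_i + i v_{i+1} - (n + 1) u_i compares the two normalized
    families on the first k of n equal intervals. *)
Lemma normalized_convex_mean_le (R : realType) (phi g : R -> R) (x : nat -> R)
    (sg : R) (n : nat) :
    (forall u v : R, 0 < u -> 0 < v -> phi u + g u * (v - u) <= phi v) ->
    (forall u v : R, 0 < u -> u <= v -> g u <= g v) ->
    (forall i, (1 <= i)%N -> 0 < x i) ->
    (forall k, (1 <= k)%N -> 0 <= sg * (x k.+1 - x k)) ->
    (forall k, (1 <= k)%N ->
       0 <= sg * (k.+1%:R * (x k.+2 / x k.+1) - k%:R * (x k.+1 / x k) - 1)) ->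
    (1 <= n)%N -> sg != 0 ->
  n.+1%:R * psum (fun i => phi (n%:R / psum x n * x i)) n
  <= n%:R * psum (fun i => phi (n.+1%:R / psum x n.+1 * x i)) n.+1.
Proof.
move=> phi_ge g_homo x_gt0 x_mono step n_ge1 sg_neq0.
have n_gt0 : 0 < n%:R :> R by rewrite ltr0n.
have S_gt0 : 0 < psum x n by exact: psum_gt0.
have S'_gt0 : 0 < psum x n.+1 by exact: psum_gt0.
pose u i := n%:R / psum x n * x i.
pose v i := n.+1%:R / psum x n.+1 * x i.
have u_gt0 i : (1 <= i)%N -> 0 < u i.
  by move=> i_ge1; rewrite mulr_gt0 ?divr_gt0 ?x_gt0.
have v_gt0 i : (1 <= i)%N -> 0 < v i.
  by move=> i_ge1; rewrite mulr_gt0 ?divr_gt0 ?x_gt0.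
pose d i := (n%:R + 1 - i%:R) * v i + i%:R * v i.+1 + - (n%:R + 1) * u i.
have dE k : psum d k = n%:R * psum v k + k%:R * v k.+1
                       - (n%:R + 1) * psum u k.
  rewrite -psum_overlap mulrC -mulrN mulrC -psum_mulr.
  by rewrite -psumD.
(* Both normalized families have average 1. *)
have dn0 : psum d n = 0.
  rewrite dE -mulrDr -psumS /u /v !psum_mulr -(@natr1 R n).
  by field; rewrite !gt_eqF.
have sd_le0 k : (1 <= k < n)%N -> sg * psum d k <= 0.
  case/andP=> k_ge1 /ltnW kn.
  have Sk_gt0 : 0 < psum x k by exact: psum_gt0.
  have -> : sg * psum d k = - ((n%:R + 1) * psum x k / psum x n.+1) *
      (sg * (n%:R * x n.+1 / psum x n - k%:R * x k.+1 / psum x k)).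
    rewrite dE /u /v !psum_mulr -(@natr1 R n) psumS; field.
    by rewrite -psumS !gt_eqF.
  rewrite mulNr oppr_le0 mulr_ge0 //; last exact: slope_monotone.
  by rewrite divr_ge0 ?mulr_ge0 ?addr_ge0 // ltW.
have g_mono k : (1 <= k)%N -> 0 <= sg * (g (u k.+1) - g (u k)).
  move=> k_ge1; have := x_mono k k_ge1.
  have [sg_gt0|sg_lt0|/eqP] := ltrgt0P sg; last by rewrite (negPf sg_neq0).
    rewrite !pmulr_rge0 // !subr_ge0 => xk; apply: g_homo; first exact: u_gt0.
    by rewrite ler_pM2l ?divr_gt0.
  rewrite !nmulr_rge0 // !subr_le0 => xk; apply: g_homo; first exact: u_gt0.
  by rewrite ler_pM2l ?divr_gt0.
have abel : 0 <= psum (fun i => g (u i) * d i) n.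
  rewrite -(mulr0 (g (u n))) -[in leLHS]dn0.
  apply: abel_sum_ge => // k /andP[k_ge1 kn].
  have sg2_gt0 : 0 < sg ^+ 2 by rewrite exprn_even_gt0.
  rewrite -(pmulr_rge0 _ sg2_gt0).
  have -> : sg ^+ 2 * ((g (u k) - g (u k.+1)) * psum d k)
    = (sg * (g (u k.+1) - g (u k))) * - (sg * psum d k) by ring.
  by rewrite mulr_ge0 ?g_mono // oppr_ge0 sd_le0 // k_ge1.
(* It remains to sum the tangent inequalities at u_i for the values v_i and
   v_{i+1}, with the weights of psum_overlap. *)
rewrite -[n.+1%:R * _]addr0; apply: (le_trans (lerD (lexx _) abel)).
have -> : n%:R * psum (fun i => phi (v i)) n.+1
    = psum (fun i => (n%:R + 1 - i%:R) * phi (v i) + i%:R * phi (v i.+1)) n.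
  by rewrite (psum_overlap (phi \o v)) -mulrDr -psumS.
rewrite -psum_mulr -psumD; apply: ler_psum => i /andP[i_ge1 i_le].
have A := phi_ge _ _ (u_gt0 _ i_ge1) (v_gt0 _ i_ge1).
have B := phi_ge _ _ (u_gt0 _ i_ge1) (v_gt0 i.+1 isT).
have wi : 0 <= n%:R + 1 - i%:R :> R.
  by rewrite subr_ge0 natr1 ler_nat (leq_trans i_le).
have := ler_wpM2l wi A; have := ler_wpM2l (ler0n R i) B.
rewrite -/(u i) /d -(@natr1 R n).
by lra.
Qed.

(** * Tangent lines of real powers and of the logarithm *)

Lemma powRV (R : realType) (x r : R) : 0 <= x -> x^-1 `^ r = (x `^ r)^-1.
Proof. by move=> x_ge0; rewrite -powR_inv1 // -powRrM mulN1r powRN. Qed.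

(** Dividing by u^p turns this into Bernoulli's inequality for w = v / u, which
    is Young's inequality for the pair w, 1 and the exponent p. *)
Lemma powR_ge_tangent (R : realType) (p u v : R) :
  1 <= p -> 0 < u -> 0 < v -> u `^ p + p * u `^ (p - 1) * (v - u) <= v `^ p.
Proof.
move=> p_ge1 u_gt0 v_gt0.
have [<-|p_neq1] := eqVneq 1 p.
  by rewrite subrr powRr0 !powRr1 ?(ltW u_gt0) ?(ltW v_gt0) //; lra.
have p_gt1 : 1 < p by rewrite lt_neqAle p_neq1.
have p_gt0 : 0 < p by lra.
have up : u `^ p = u * u `^ (p - 1).
  by rewrite -{2}[u]powRr1 ?ltW // -powRD ?gt_eqF ?implybT // addrC subrK.
have w_gt0 : 0 < v / u by rewrite divr_gt0.
have vp : v `^ p = u `^ p * (v / u) `^ p.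
  by rewrite -powRM ?ltW // mulrC divfK // gt_eqF.
have q_gt0 : 0 < (1 - p^-1)^-1 :> R.
  by rewrite invr_gt0 subr_gt0 invf_lt1.
have := @conjugate_powR _ (v / u) 1 p _ (ltW w_gt0) ler01 p_gt0 q_gt0.
rewrite invrK addrCA subrr addr0 => /(_ erefl).
rewrite powR1 mulr1 mul1r => young.
have {}young : 1 + p * (v / u - 1) <= (v / u) `^ p.
  rewrite -subr_ge0.
  have -> : (v / u) `^ p - (1 + p * (v / u - 1))
    = p * ((v / u) `^ p / p + (1 - p^-1) - v / u) by field; rewrite !gt_eqF.
  by rewrite mulr_ge0 ?(ltW p_gt0) // subr_ge0.
have -> : u `^ p + p * u `^ (p - 1) * (v - u)
    = u `^ p * (1 + p * (v / u - 1)) by rewrite up; field; rewrite gt_eqF.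
by rewrite vp ler_wpM2l // powR_ge0.
Qed.

Lemma lnN_ge_tangent (R : realType) (u v : R) :
  0 < u -> 0 < v -> - ln u + - u^-1 * (v - u) <= - ln v.
Proof.
move=> u_gt0 v_gt0.
have w_gt0 : 0 < v / u by rewrite divr_gt0.
have : ln (v / u) <= v / u - 1.
  by rewrite -{1}(subrKC 1 (v / u)) le_ln1Dx //; lra.
rewrite ln_div ?posrE //.
have -> : - u^-1 * (v - u) = 1 - v / u by field; rewrite gt_eqF.
by lra.
Qed.

(** * Means of powers *)

Lemma power_avgE (R : realType) (a : nat -> R) n r :
  power_avg a n r = n%:R^-1 * psum (fun i => a i `^ r) n.
Proof. by []. Qed.

Lemma power_avg_gt0 (R : realType) (a : nat -> R) n r :
  (forall i, (1 <= i)%N -> 0 < a i) -> (1 <= n)%N -> 0 < power_avg a n r.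
Proof.
move=> a_gt0 n_ge1; rewrite power_avgE mulr_gt0 ?invr_gt0 ?ltr0n //.
by apply: psum_gt0 => // i i_ge1; rewrite powR_gt0 ?a_gt0.
Qed.

Lemma geometric_mean_gt0 (R : realType) (a : nat -> R) n :
  (forall i, (1 <= i)%N -> 0 < a i) -> 0 < geometric_mean a n.
Proof.
move=> a_gt0; rewrite powR_gt0 // big_nat prodr_gt0 // => i /andP[i_ge1 _].
exact: a_gt0.
Qed.

Lemma ln_geometric_mean (R : realType) (a : nat -> R) n :
    (forall i, (1 <= i)%N -> 0 < a i) ->
  ln (geometric_mean a n) = n%:R^-1 * psum (fun i => ln (a i)) n.
Proof.
move=> a_gt0; rewrite ln_powR; congr (_ * _).
elim: n => [|n IHn]; first by rewrite psum0 big_geq // ln1.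
rewrite psumS big_nat_recr //= lnM ?IHn // posrE ?a_gt0 // big_nat.
by rewrite prodr_gt0 // => i /andP[i_ge1 _]; exact: a_gt0.
Qed.

(** For 0 < s < r the function t^(r/s) is applied to the powers b_i^s; for s = 0
    the function - ln is applied to the powers b_i^r. *)
Lemma mean_ratio_decreasing (R : realType) (b : nat -> R) (sg : R) (n : nat) :
    (forall i, (1 <= i)%N -> 0 < b i) -> sg != 0 -> (1 <= n)%N ->
    (forall r k, 0 < r -> (1 <= k)%N -> 0 <= sg * (b k.+1 `^ r - b k `^ r)) ->
    (forall r k, 0 < r -> (1 <= k)%N ->
       0 <= sg * (k.+1%:R * (b k.+2 `^ r / b k.+1 `^ r)
                  - k%:R * (b k.+1 `^ r / b k `^ r) - 1)) ->
  forall s r, 0 <= s -> s <= r -> mean_ratio b n r <= mean_ratio b n s.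
Proof.
move=> b_gt0 sg_neq0 n_ge1 mono step s r s_ge0.
rewrite le_eqVlt => /predU1P[->//|sr].
have r_gt0 : 0 < r by exact: le_lt_trans sr.
have n_gt0 : 0 < n%:R :> R by rewrite ltr0n.
have pow_gt0 t i : (1 <= i)%N -> 0 < b i `^ t.
  by move=> i_ge1; rewrite powR_gt0 ?b_gt0.
have A_gt0 t : 0 < power_avg b n t by exact: power_avg_gt0.
have A'_gt0 t : 0 < power_avg b n.+1 t by exact: power_avg_gt0.
have AE t m : (1 <= m)%N ->
    m%:R / psum (fun i => b i `^ t) m = (power_avg b m t)^-1.
  by move=> m_ge1; rewrite power_avgE invfM invrK.
rewrite /mean_ratio (gt_eqF r_gt0).
have [s0|s_neq0] := eqVneq s 0.
  have G_gt0 m : 0 < geometric_mean b m by exact: geometric_mean_gt0.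
  rewrite -ler_ln ?posrE ?powR_gt0 ?divr_gt0 // ln_powR !ln_div ?posrE //.
  rewrite ler_pdivrMl //.
  have := @normalized_convex_mean_le R (fun t => - ln t) (fun t => - t^-1)
    (fun i => b i `^ r) sg n (@lnN_ge_tangent R) _ (pow_gt0 r)
    (fun k => mono r k r_gt0) (fun k => step r k r_gt0) n_ge1 sg_neq0.
  rewrite (AE r n n_ge1) (AE r n.+1 isT).
  have sumE m : (1 <= m)%N ->
      psum (fun i => - ln ((power_avg b m r)^-1 * b i `^ r)) m
      = m%:R * (ln (power_avg b m r) - r * ln (geometric_mean b m)).
    move=> m_ge1; have m_gt0 : 0 < m%:R :> R by rewrite ltr0n.
    have Am_gt0 : 0 < power_avg b m r by exact: power_avg_gt0.
    rewrite ln_geometric_mean //.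
    rewrite (@eq_psum _ _ (fun i => ln (power_avg b m r) + (- r) * ln (b i))).
      rewrite {1}/psum big_split /= big_const_nat iter_addr_0 subn1.
      rewrite -/(psum (fun i => - r * ln (b i)) m) psum_mulr.
      by rewrite -mulr_natl; field; rewrite gt_eqF.
    move=> i i_ge1; rewrite lnM ?posrE ?invr_gt0 ?pow_gt0 // lnV ?posrE //.
    by rewrite ln_powR; ring.
  rewrite (sumE n n_ge1) (sumE n.+1 isT) mulrCA.
  rewrite (ler_pM2l n_gt0) (ler_pM2l (ltr0Sn R n)).
  have inv_homo (u v : R) : 0 < u -> u <= v -> - u^-1 <= - v^-1.
    move=> u_gt0 uv; rewrite lerN2 lef_pV2 ?posrE //; lra.
  move=> /(_ inv_homo); lra.
have s_gt0 : 0 < s by rewrite lt_neqAle eq_sym s_neq0.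
pose p := r / s.
have p_ge1 : 1 <= p by rewrite ler_pdivlMr // mul1r ltW.
have sp : s * p = r by rewrite mulrC divfK.
have := @normalized_convex_mean_le R (fun t => t `^ p)
    (fun t => p * t `^ (p - 1))
    (fun i => b i `^ s) sg n (fun u v => @powR_ge_tangent R p u v p_ge1) _
    (pow_gt0 s)
    (fun k => mono s k s_gt0) (fun k => step s k s_gt0) n_ge1 sg_neq0.
rewrite (AE s n n_ge1) (AE s n.+1 isT).
have sumE m : (1 <= m)%N ->
    psum (fun i => ((power_avg b m s)^-1 * b i `^ s) `^ p) m
    = m%:R * (power_avg b m r / power_avg b m s `^ p).
  move=> m_ge1; have m_gt0 : 0 < m%:R :> R by rewrite ltr0n.
  have Am_gt0 : 0 < power_avg b m s by exact: power_avg_gt0.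
  rewrite (@eq_psum _ _ (fun i => (power_avg b m s `^ p)^-1 * b i `^ r)).
    rewrite psum_mulr (power_avgE _ _ r); field.
    by rewrite !gt_eqF // powR_gt0.
  move=> i i_ge1; rewrite powRM ?invr_ge0 ?powR_ge0 ?(ltW Am_gt0) //.
  by rewrite powRV ?(ltW Am_gt0) // -powRrM sp.
rewrite (sumE n n_ge1) (sumE n.+1 isT) mulrCA.
rewrite (ler_pM2l n_gt0) (ler_pM2l (ltr0Sn R n)).
have g_homo (u v : R) : 0 < u -> u <= v -> p * u `^ (p - 1) <= p * v `^ (p - 1).
  move=> u_gt0 uv; rewrite ler_wpM2l //; first lra.
  by apply: ge0_ler_powR; rewrite ?nnegrE; lra.
move=> /(_ g_homo) avg_le.
have ratio_le : power_avg b n r / power_avg b n.+1 r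
    <= (power_avg b n s / power_avg b n.+1 s) `^ p.
  rewrite powRM ?invr_ge0 ?(ltW (A_gt0 _)) ?(ltW (A'_gt0 _)) //.
  rewrite powRV ?(ltW (A'_gt0 _)) //.
  move: avg_le; rewrite !ler_pdivrMr ?powR_gt0 //.
  by rewrite mulrAC [X in X / _]mulrC mulrAC.
have -> : s^-1 = p * r^-1 by rewrite /p; field; rewrite !gt_eqF.
rewrite powRrM; apply: ge0_ler_powR => //.
- by rewrite invr_ge0 ltW.
- by rewrite nnegrE divr_ge0 ?ltW.
- by rewrite nnegrE powR_ge0.
Qed.

(** * Passage to the sequence of inverses *)

Lemma power_avgV (R : realType) (a : nat -> R) n r :
    (forall i, (1 <= i)%N -> 0 < a i) ->
  power_avg (fun i => (a i)^-1) n r = power_avg a n (- r).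
Proof.
move=> a_gt0; rewrite !power_avgE; congr (_ * _).
by apply: eq_psum => i i_ge1; rewrite powRV ?powRN // ltW ?a_gt0.
Qed.

Lemma mean_ratioV (R : realType) (a : nat -> R) n r :
    (forall i, (1 <= i)%N -> 0 < a i) -> (1 <= n)%N ->
  mean_ratio a n r = (mean_ratio (fun i => (a i)^-1) n (- r))^-1.
Proof.
move=> a_gt0 n_ge1; rewrite /mean_ratio oppr_eq0 !power_avgV // opprK.
have geomV m : geometric_mean (fun i => (a i)^-1) m = (geometric_mean a m)^-1.
  rewrite /geometric_mean prodfV powRV // big_nat prodr_ge0 // => i.
  by case/andP=> i_ge1 _; rewrite ltW // a_gt0.
case: eqP => _; first by rewrite !geomV invfM !invrK.
by rewrite invrN powRN invrK.
Qed.

(** * Monotonicity of the ratio of means *)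

Unset Implicit Arguments.
Set Strict Implicit.

Theorem corollary2p2 (R : realType) (a : nat -> R)
    (a_gt0 : forall i : nat, (1 <= i)%N -> 0 < a i)
    (a_incr : forall i j : nat, (1 <= i)%N -> (i <= j)%N -> a i <= a j) :
  ((forall (r : R) (n : nat), 0 < r -> (2 <= n)%N ->
      forall i : nat, (1 <= i <= n - 1)%N ->
        (n - i)%:R * (a (n + 1 - i)%N `^ r / a (n - i)%N `^ r) + 1
        <= (n - i + 1)%:R * (a (n + 2 - i)%N `^ r / a (n + 1 - i)%N `^ r)) ->
    forall n : nat, (1 <= n)%N ->
      {in `[0, +oo[ &, {homo mean_ratio a n : r s / r <= s >-> s <= r}})
  /\
  ((forall (r : R) (n : nat), 0 < r -> (2 <= n)%N ->
      forall i : nat, (1 <= i <= n - 1)%N ->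
        (i + 1)%:R * (a (i + 1)%N `^ r / a (i + 2)%N `^ r)
        <= 1 + i%:R * (a i `^ r / a (i + 1)%N `^ r)) ->
    forall n : nat, (1 <= n)%N ->
      {in `]-oo, 0] &, {homo mean_ratio a n : r s / r <= s >-> s <= r}}).
Proof.
have pow_homo r k : 0 < r -> (1 <= k)%N -> a k `^ r <= a k.+1 `^ r.
  move=> r_gt0 k_ge1; apply: ge0_ler_powR; rewrite ?nnegrE ?a_incr //;
  by rewrite ltW ?a_gt0.
split=> step n n_ge1 r s.
  rewrite !in_itv /= !andbT => r_ge0 s_ge0 rs.
  apply: (@mean_ratio_decreasing R a 1) => // {r_ge0 s_ge0 rs}.
    by move=> t k t_gt0 k_ge1; rewrite mul1r subr_ge0 pow_homo.
  (* Only n - i enters the hypothesis, so n = k + 1 and i = 1 give the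
     inequality at the index k. *)
  move=> t k t_gt0 k_ge1; have := step t k.+1 t_gt0.
  rewrite ltnS => /(_ k_ge1 1%N); rewrite subn1 k_ge1 => /(_ isT).
  by rewrite !addnK !addn1 -[2%N]/(1 + 1)%N addnA addnK !addn1; lra.
rewrite !in_itv /= => r_le0 s_le0 rs.
rewrite (mean_ratioV r a_gt0 n_ge1) (mean_ratioV s a_gt0 n_ge1).
have b_gt0 i : (1 <= i)%N -> 0 < (a i)^-1 by move=> ?; rewrite invr_gt0 a_gt0.
have ratio_gt0 t : 0 < mean_ratio (fun i => (a i)^-1) n t.
  rewrite /mean_ratio; case: eqP => _.
    by rewrite divr_gt0 // geometric_mean_gt0.
  by rewrite powR_gt0 // divr_gt0 // power_avg_gt0.
rewrite lef_pV2; [|exact: ratio_gt0..].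
have powV t k : (1 <= k)%N -> (a k)^-1 `^ t = (a k `^ t)^-1.
  by move=> k_ge1; rewrite powRV // ltW ?a_gt0.
apply: (@mean_ratio_decreasing R _ (- 1));
  rewrite ?oppr_eq0 ?oppr_ge0 ?lerN2 //.
- move=> t k t_gt0 k_ge1; rewrite !powV // mulN1r oppr_ge0 subr_le0.
  by rewrite lef_pV2 ?posrE ?powR_gt0 ?a_gt0 // pow_homo.
move=> t k t_gt0 k_ge1; rewrite !powV // !invrK.
have := step t k.+1 t_gt0.
rewrite ltnS subn1 => /(_ k_ge1 k); rewrite k_ge1 leqnn => /(_ isT).
by rewrite addn2 !addn1; lra.
Qed.
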